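(* 1. Let $P,Q$ be finite posets. Then $P$ and $Q$ are simply equivalent if and only if the comparability graphs $Comp(P)$ and $Comp(Q)$ have the same s-homotopy type. 2. Let $G,H$ be finite simple graphs. Then $G$ and $H$ have the same s-homotopy type if and only if the posets $C(G)$ and $C(H)$ are simply equivalent.
   Context: Graphs are finite, undirected, without loops or multiple edges, considered up to isomorphism. $N_G(g)$ is the set of neighbours of $g$, $N_G[g]=N_G(g)\cup\{g\}$; vertex sets are identified with induced subgraphs. A vertex $g$ is dominated by $g'\ne g$ if $N_G[g]\subseteq N_G[g']$. A graph is dismantlable if it has one vertex, or its vertices can be listed $g_1,\dots,g_n$ so that each $g_i$ ($2\le i\le n$) is dominated by another vertex in the subgraph induced by $\{g_1,\dots,g_i\}$. A vertex $g$ is s-dismantlable in $G$ if the induced subgraph $N_G(g)$ is dismantlable. Two graphs have the same s-homotopy type if one can be transformed into the other by a finite sequence of deletions of s-dismantlable vertices and additions of new vertices that are s-dismantlable in the enlarged graph. For a finite poset $P$ and $x\in P$, $P_{<x}=\{y: y<x\}$, $P_{>x}=\{y:y>x\}$ (as subposets). $x$ is irreducible if $P_{<x}$ has a maximum or $P_{>x}$ has a minimum. $P$ is dismantlable if $P=\{x_1,\dots,x_n\}$ with $n\ge1$ and each $x_i$ ($2\le i\le n$) irreducible in the subposet $\{x_1,\dots,x_i\}$. A point $x$ is a weak point of $P$ if $P_{<x}$ or $P_{>x}$ is dismantlable. $P$ and $Q$ are simply equivalent if one can be obtained from the other by a finite sequence of deletions of weak points and additions of points that are weak points in the enlarged poset.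 $Comp(P)$ is the graph on $P$ with $x\sim y$ iff $x\ne y$ are comparable. $C(G)$ is the poset of nonempty complete subgraphs of $G$ ordered by inclusion. *)

(* Defs.v *)
From HB Require Import structures.
From mathcomp Require Import all_boot all_order.

Set Implicit Arguments.
Unset Strict Implicit.
Unset Printing Implicit Defensive.

Import Order.TTheory.
Local Open Scope order_scope.

(* A is dismantlable with respect to [removable] when its elements can be
   listed without repetition as x_1, ..., x_n, n >= 1, with x_i removable from
   {x_1, ..., x_i} for 2 <= i <= n; below, x_i is x and s1 is x_1 ... x_(i-1). *)
Definition dismantlable_by (T : finType) (removable : {set T} -> T -> Prop)
    (A : {set T}) : Prop :=
  exists s : seq T,
    [/\ s <> [::], uniq s, A = [set:: s] &
        forall (s1 : seq T) (x : T) (s2 : seq T),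
          s = s1 ++ x :: s2 -> s1 <> [::] -> removable [set:: rcons s1 x] x].

Record sgraph := SGraph {
  vertex :> finType;
  adj : rel vertex;
  adj_sym : symmetric adj;
  adj_irrefl : irreflexive adj }.

Definition graph_iso (G H : sgraph) : Prop :=
  exists2 f : G -> H, bijective f & {mono f : x y / adj x y}.

(* Neighbourhoods in the subgraph of G induced by A. *)
Definition open_nbhd (G : sgraph) (A : {set G}) (g : G) : {set G} :=
  [set h in A | adj g h].

Definition closed_nbhd (G : sgraph) (A : {set G}) (g : G) : {set G} :=
  g |: open_nbhd A g.

Definition dominated_in (G : sgraph) (A : {set G}) (g : G) : Prop :=
  exists g' : G,
    [/\ g' \in A, g' != g & closed_nbhd A g \subset closed_nbhd A g'].

Definition graph_dismantlable (G : sgraph) (A : {set G}) : Prop :=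
  dismantlable_by (@dominated_in G) A.

Definition s_dismantlable (G : sgraph) (g : G) : Prop :=
  graph_dismantlable (open_nbhd [set: G] g).

Section InducedSubgraph.
Variables (G : sgraph) (A : {set G}).
Let sub_adj : rel {x : G | x \in A} := fun x y => adj (val x) (val y).

Fact sub_adj_sym : symmetric sub_adj.
Proof. by move=> x y; apply: adj_sym. Qed.

Fact sub_adj_irrefl : irreflexive sub_adj.
Proof. by move=> x; apply: adj_irrefl. Qed.

Definition induced : sgraph := SGraph sub_adj_sym sub_adj_irrefl.
End InducedSubgraph.

Definition del_vertex (G : sgraph) (g : G) : sgraph := induced [set~ g].

(* Graphs are taken up to isomorphism, hence the isomorphism in every step. *)
Inductive same_s_homotopy_type (G : sgraph) : sgraph -> Prop :=
| same_s_iso (H : sgraph) : graph_iso G H -> same_s_homotopy_type G H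
| same_s_del (H K : sgraph) (h : H) :
    same_s_homotopy_type G H -> s_dismantlable h ->
    graph_iso (del_vertex h) K -> same_s_homotopy_type G K
| same_s_add (H K : sgraph) (k : K) :
    same_s_homotopy_type G H -> s_dismantlable k ->
    graph_iso (del_vertex k) H -> same_s_homotopy_type G K.

Definition poset_iso d (P : finPOrderType d) d' (Q : finPOrderType d') : Prop :=
  exists2 f : P -> Q, bijective f & {mono f : x y / x <= y}.

Section PosetDismantling.
Variables (d : Order.disp_t) (P : finPOrderType d).
Implicit Types (A : {set P}) (x : P).

Definition below A x : {set P} := [set y in A | y < x].
Definition above A x : {set P} := [set y in A | x < y].

Definition has_maximum A : Prop := exists2 m : P, m \in A & {in A, forall y, y <= m}.
Definition has_minimum A : Prop := exists2 m : P, m \in A & {in A, forall y, m <= y}.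

Definition irreducible_in A x : Prop :=
  has_maximum (below A x) \/ has_minimum (above A x).

Definition poset_dismantlable A : Prop := dismantlable_by irreducible_in A.

Definition weak_point x : Prop :=
  poset_dismantlable (below [set: P] x) \/ poset_dismantlable (above [set: P] x).
End PosetDismantling.

Definition subposet d (P : finPOrderType d) (A : {set P}) : Type :=
  {x : P | x \in A}.

Section SubPoset.
Variables (d : Order.disp_t) (P : finPOrderType d) (A : {set P}).
HB.instance Definition _ := SubFinite.copy (subposet A) {x : P | x \in A}.
HB.instance Definition _ :=
  [SubChoice_isSubPOrder of subposet A by <: with d].
End SubPoset.

Definition del_point d (P : finPOrderType d) (x : P) : finPOrderType d :=
  subposet [set~ x].

(* As for graphs, steps are taken up to isomorphism; displays, which carry no
   order-theoretic content, may vary along the sequence. *)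
Inductive simply_equivalent d (P : finPOrderType d) :
    forall d', finPOrderType d' -> Prop :=
| simply_iso d1 (Q : finPOrderType d1) :
    poset_iso P Q -> simply_equivalent P Q
| simply_del d1 (Q : finPOrderType d1) d2 (R : finPOrderType d2) (q : Q) :
    simply_equivalent P Q -> weak_point q ->
    poset_iso (del_point q) R -> simply_equivalent P R
| simply_add d1 (Q : finPOrderType d1) d2 (R : finPOrderType d2) (r : R) :
    simply_equivalent P Q -> weak_point r ->
    poset_iso (del_point r) Q -> simply_equivalent P R.

Section Comp.
Variables (d : Order.disp_t) (P : finPOrderType d).
Let comp_adj : rel P := fun x y => (x != y) && (x >=< y).

Fact comp_adj_sym : symmetric comp_adj.
Proof. by move=> x y; rewrite /comp_adj eq_sym comparable_sym. Qed.

Fact comp_adj_irrefl : irreflexive comp_adj.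
Proof. by move=> x; rewrite /comp_adj eqxx. Qed.

Definition Comp : sgraph := SGraph comp_adj_sym comp_adj_irrefl.
End Comp.

Definition is_complete (G : sgraph) (A : {set G}) : bool :=
  [forall x in A, forall y in A, (x != y) ==> adj x y].

Definition complete_subgraph (G : sgraph) : Type :=
  {A : {set G} | (A != set0) && is_complete A}.

Section CliquePoset.
Variable G : sgraph.
HB.instance Definition _ :=
  SubFinite.copy (complete_subgraph G)
    {A : {set G} | (A != set0) && is_complete A}.

Let clique_le : rel (complete_subgraph G) := fun A B => val A \subset val B.

Fact clique_le_refl : reflexive clique_le.
Proof. by move=> A; apply: subxx. Qed.

Fact clique_le_anti : antisymmetric clique_le.
Proof. by move=> A B sAB; apply/val_inj/eqP; rewrite eqEsubset. Qed.

Fact clique_le_trans : transitive clique_le.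
Proof. by move=> B A D; apply: subset_trans. Qed.

HB.instance Definition _ :=
  Order.Le_isPOrder.Build (Order.Disp tt tt) (complete_subgraph G)
    clique_le_refl clique_le_anti clique_le_trans.
End CliquePoset.

Definition C (G : sgraph) : finPOrderType (Order.Disp tt tt) :=
  complete_subgraph G.

(* Main.v *)
(* Both functors respect single moves: the neighbourhood of a point of [P] in
   [Comp P] is the join of the part below with the part above, and a join with
   one dismantlable factor is dismantlable; if [g] is s-dismantlable, then [{g}]
   is a weak point of [C G], and the larger cliques containing [g] can then be
   removed in increasing order, each being left with a greatest element below it,
   obtained by dropping [g].

   It remains to compare [P] with [C (Comp P)] and [G] with [Comp (C G)].  Both
   comparisons use a "mapping cylinder" on the disjoint union, from which either
   summand can be removed by elementary moves:
   - for posets, a chain [c] lies below [p] when all its elements are [<= p].  A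
     chain, once the larger ones are gone, has its maximum as least element
     above; a point [p], once the smaller ones are gone, has below it the chains
     of the cone of elements [<= p];
   - for graphs, a clique [s] is adjacent to [g] when [s] is contained in the
     closed neighbourhood of [g].  A clique, once the larger ones are gone, is
     dominated by any of its vertices; the neighbourhood of a vertex [g]
     dismantles by sending [s] to [g |: s], and then [{g}] is a cone point. *)

Require Import Defs.
From HB Require Import structures.
From mathcomp Require Import all_boot all_order.

Set Implicit Arguments.
Unset Strict Implicit.
Unset Printing Implicit Defensive.

Import Order.TTheory.

(** * Collapses and dismantlings *)

Section Collapses.
Variable T : finType.
Implicit Types (A B D : {set T}) (x y : T) (rem : {set T} -> T -> Prop).

(** Removability is tested in the current set. Since the end set is arbitrary, the same relation
    serves for dismantlings and for chains of deletions of weak points or s-dismantlable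
    vertices. *)
Inductive collapses rem : {set T} -> {set T} -> Prop :=
| collapses_refl A : collapses rem A A
| collapses_step A B x :
    x \in A -> rem A x -> collapses rem (A :\ x) B -> collapses rem A B.

Lemma collapses_sub rem rem' A B :
    (forall A x, x \in A -> rem A x -> rem' A x) ->
  collapses rem A B -> collapses rem' A B.
Proof.
move=> sub; elim=> [{}A|{}A {}B x xA remx _ IH]; first exact: collapses_refl.
by apply: collapses_step IH => //; apply: sub.
Qed.

(** An element of [D] of least rank is removed first, and so on. When [x] is tested, [B] is the
    current set: it still contains [A :\: D], and no element of [D] left in it has rank below [r x].
    Choosing [r] thus fixes the order of removal. *)
Lemma collapses_ranked rem (r : T -> nat) A D :
    D \subset A ->
    (forall B x, A :\: D \subset B -> B \subset A -> x \in B -> x \in D ->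
       (forall y, y \in B -> y \in D -> r x <= r y) -> rem B x) ->
  collapses rem A (A :\: D).
Proof.
have [n] := ubnP #|D|; elim: n => // n IH in A D * => /ltnSE-leDn sDA remD.
have [->|/set0Pn [x0 x0D]] := eqVneq D set0.
  by rewrite setD0; apply: collapses_refl.
case: (arg_minnP r x0D) => x xinD minx; have xD : x \in D := xinD.
have xA := subsetP sDA _ xD.
apply: (@collapses_step _ _ _ x) => //.
  by apply: remD; rewrite ?subsetDl // => y _; apply: minx.
have -> : A :\: D = (A :\ x) :\: (D :\ x).
  by apply/setP => y; rewrite !inE; case: eqVneq => [->|] //=; rewrite xD.
apply: IH; first by move: leDn; rewrite (cardsD1 x) xD.
  exact: setSD.
move=> B y sB sBA yB yDx miny; apply: remD => //.
- apply: subset_trans sB; apply/subsetP=> z; rewrite !inE.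
  by case: eqVneq => [->|] //=; rewrite xD.
- exact: subset_trans sBA (subsetDl _ _).
- by move: yDx; rewrite !inE => /andP[].
move=> z zB zD; apply: miny => //; rewrite !inE zD andbT.
by have := subsetP sBA _ zB; rewrite !inE => /andP[].
Qed.

Lemma dismantlable_by1 rem x : dismantlable_by rem [set x].
Proof.
exists [:: x]; split=> //; first by rewrite set_seq1.
by case=> [|? []].
Qed.

Lemma dismantlable_byS rem A x :
    x \in A -> rem A x -> dismantlable_by rem (A :\ x) ->
  dismantlable_by rem A.
Proof.
move=> xA remx [s [s_n0 us eqs rems]].
have xs : x \notin s by have := setD11 x A; rewrite eqs inE => /negbT.
have eqA : A = [set:: rcons s x].
  by rewrite -(setD1K xA) eqs; apply/setP=> y; rewrite !inE mem_rcons inE.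
exists (rcons s x); split=> //; first by case: (s).
  by rewrite rcons_uniq xs.
move=> s1 y s2; case/lastP: s2 => [|s2 z].
  by rewrite cats1 => /rcons_inj [<- <-] _; rewrite -eqA.
by rewrite -rcons_cons -rcons_cat => /rcons_inj [/rems].
Qed.

(** Reading the listing from its end turns dismantlability into an inductive predicate, so that no
    later argument handles lists. *)
Lemma dismantlable_by_rect rem (K : {set T} -> Prop) :
    (forall x, K [set x]) ->
    (forall A x, x \in A -> rem A x -> dismantlable_by rem (A :\ x) ->
       K (A :\ x) -> K A) ->
  forall A, dismantlable_by rem A -> K A.
Proof.
move=> K1 KS A [s []]; elim/last_ind: s A => [//|s x IH] A _ us eqA rems.
have [s0|s_n0] := eqVneq s [::].
  by have -> : A = [set x] by rewrite eqA s0 set_seq1.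
move: us; rewrite rcons_uniq => /andP[xs us].
have eqAx : A :\ x = [set:: s].
  rewrite eqA; apply/setP=> y; rewrite !inE mem_rcons inE.
  by case: eqVneq => [->|] //=; rewrite (negPf xs).
have rems' (s1 : seq T) (y : T) (s2 : seq T) : s = s1 ++ y :: s2 -> s1 <> [::] ->
    rem [set:: rcons s1 y] y.
  by move=> eqs; apply: (rems _ _ (rcons s2 x)); rewrite eqs rcons_cat.
have s_n0' := elimN eqP s_n0.
apply: (KS A x); first by rewrite eqA inE mem_rcons mem_head.
- by rewrite eqA; apply: (rems s x [::]) => //; rewrite cats1.
- by exists s.
exact: IH.
Qed.

Lemma collapses_dismantlable rem A B :
  collapses rem A B -> dismantlable_by rem B -> dismantlable_by rem A.
Proof.
elim=> // {}A {}B x xA remx _ IH /IH; exact: dismantlable_byS.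
Qed.

Lemma dismantlable_by_sub rem rem' A :
    (forall A x, x \in A -> rem A x -> rem' A x) ->
  dismantlable_by rem A -> dismantlable_by rem' A.
Proof.
move=> sub; elim/dismantlable_by_rect: A / => [x|A x xA remx _].
  exact: dismantlable_by1.
by apply: dismantlable_byS => //; apply: sub.
Qed.

End Collapses.

(** * Transport of dismantlings along injections *)

Lemma imsetD1_inj (T T' : finType) (f : T -> T') (A : {set T}) (x : T) :
  injective f -> f @: (A :\ x) = f @: A :\ f x.
Proof.
move=> f_inj; apply/setP=> y; rewrite !inE; apply/imsetP/andP.
  case=> z; rewrite !inE => /andP[neq_zx zA] ->.
  by rewrite (inj_eq f_inj) neq_zx imset_f.
case=> neq /imsetP [z zA def_y]; exists z; rewrite ?inE ?zA ?andbT //.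
by apply: contraNneq neq => <-; rewrite def_y.
Qed.

Lemma dismantlable_by_reflect (T T' : finType) (f : T -> T')
    (rem : {set T} -> T -> Prop) (rem' : {set T'} -> T' -> Prop) :
    injective f ->
    (forall (A : {set T}) x, x \in A -> rem' (f @: A) (f x) -> rem A x) ->
  forall A : {set T}, dismantlable_by rem' (f @: A) -> dismantlable_by rem A.
Proof.
move=> f_inj sub A; move eqB: (f @: A) => B dB.
elim/dismantlable_by_rect: B / dB A eqB => [y|B y yB remy _ IH] A eqB.
  have /imsetP [x xA def_y] : y \in f @: A by rewrite eqB inE.
  have -> : A = [set x]; last exact: dismantlable_by1.
  apply: (imset_inj f_inj); rewrite eqB imset_set1; congr [set _]; exact: def_y.
move: yB remy IH; rewrite -eqB => /imsetP [x xA ->] /sub-/(_ xA) remx IH.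
apply: dismantlable_byS xA remx _; apply: IH.
by rewrite imsetD1_inj.
Qed.

Lemma dismantlable_by_imset (T T' : finType) (f : T -> T')
    (rem : {set T} -> T -> Prop) (rem' : {set T'} -> T' -> Prop) :
    injective f ->
    (forall (A : {set T}) x, x \in A -> rem A x -> rem' (f @: A) (f x)) ->
  forall A : {set T}, dismantlable_by rem A -> dismantlable_by rem' (f @: A).
Proof.
move=> f_inj sub A; elim/dismantlable_by_rect: A / => [x|A x xA remx _ IH].
  by rewrite imset_set1; apply: dismantlable_by1.
apply: (dismantlable_byS (x := f x)); first exact: imset_f.
  exact: sub.
by rewrite -imsetD1_inj.
Qed.

(** * Graphs *)

Section Graphs.
Implicit Types G H K : sgraph.

Lemma graph_iso_refl G : graph_iso G G.
Proof. by exists id => //; exists id. Qed.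

Lemma graph_iso_sym G H : graph_iso G H -> graph_iso H G.
Proof.
case=> f [g fK gK] f_adj; exists g; first by exists f.
by move=> x y; rewrite -f_adj !gK.
Qed.

Lemma graph_iso_trans H G K : graph_iso G H -> graph_iso H K -> graph_iso G K.
Proof.
case=> f f_bij f_adj [g g_bij g_adj]; exists (g \o f); first exact: bij_comp.
by move=> x y; rewrite /= g_adj f_adj.
Qed.

Lemma induced_iso G H (f : G -> H) (B : {set H}) :
    injective f -> {mono f : x y / adj x y} ->
    (forall x, f x \in B) -> (forall y, y \in B -> exists x, f x = y) ->
  graph_iso G (induced B).
Proof.
move=> f_inj f_adj fB f_surj.
exists (fun x => exist _ (f x) (fB x) : induced B) => //.
apply: inj_card_bij => [x y [/f_inj]//|].
rewrite card_sig -(card_imset _ f_inj); apply: subset_leq_card.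
by apply/subsetP=> y /f_surj [x <-]; apply: imset_f.
Qed.

Lemma graph_dismantlable_reflect G H (f : G -> H) (A : {set G}) :
    injective f -> {mono f : x y / adj x y} ->
  graph_dismantlable (f @: A) -> graph_dismantlable A.
Proof.
move=> f_inj f_adj; apply: dismantlable_by_reflect => // {}A x xA.
case=> _ [/imsetP [y yA ->] neq_yx sub].
exists y; split=> //; first by apply: contraNneq neq_yx => ->.
apply/subsetP=> z; have /subsetP/(_ (f z)) := sub.
by rewrite !inE !mem_imset // !f_adj !(inj_eq f_inj).
Qed.

(** The condition relative to the subgraph induced by [A]; it allows a sequence of deletions to be
    followed inside one fixed vertex type. *)
Definition s_dismantlable_in G (A : {set G}) (x : G) : Prop :=
  graph_dismantlable (open_nbhd A x).

Lemma s_dismantlable_reflect G H (f : G -> H) (x : G) :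
    injective f -> {mono f : x y / adj x y} ->
  s_dismantlable_in (f @: [set: G]) (f x) -> s_dismantlable x.
Proof.
move=> f_inj f_adj dis; apply: (graph_dismantlable_reflect f_inj f_adj).
congr (graph_dismantlable _): dis; apply/setP => y; rewrite !inE.
apply/andP/imsetP => [[/imsetP [z _ ->]]|[z]].
  by rewrite f_adj => xz; exists z; rewrite ?inE.
by rewrite !inE /= => xz ->; rewrite f_adj imset_f ?inE.
Qed.

Lemma s_dismantlable_iso G H (g : G) :
    graph_iso G H -> s_dismantlable g ->
  exists2 h : H, s_dismantlable h & graph_iso (del_vertex g) (del_vertex h).
Proof.
case=> f [f' fK f'K] f_adj dis; have f_inj := can_inj fK.
exists (f g).
  apply: (s_dismantlable_reflect (f := f')); first exact: can_inj f'K.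
    by move=> x y; rewrite -f_adj !f'K.
  rewrite fK; congr (graph_dismantlable (open_nbhd _ _)): dis.
  by apply/setP=> x; rewrite -{2}[x]fK inE imset_f ?inE.
apply: (@induced_iso (del_vertex g) H (fun x => f (val x)) [set~ f g]) => //.
- by move=> x y /f_inj/val_inj.
- by move=> x; rewrite inE in_set1 (inj_eq f_inj); have := valP x; rewrite !inE.
move=> y y_neq; have f'y : f' y \in [set~ g].
  by move: y_neq; rewrite !inE; apply: contraNneq => <-; rewrite f'K.
by exists (exist _ (f' y) f'y : del_vertex g); rewrite /= f'K.
Qed.

Lemma same_s_trans H G K :
  same_s_homotopy_type G H -> same_s_homotopy_type H K ->
  same_s_homotopy_type G K.
Proof.
move=> GH; elim=> {K} [K HK|K L k _ IH disk isoL|K L l _ IH disl isoK].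
- case: GH HK => {H} [H GH|H L h GL dish isoL|H L l GH disl isoH] HK.
  + by apply: same_s_iso; apply: graph_iso_trans HK.
  + by apply: same_s_del GL dish _; apply: graph_iso_trans HK.
  have [k disk iso_del] := s_dismantlable_iso HK disl.
  apply: same_s_add GH disk _; apply: graph_iso_trans isoH.
  exact: graph_iso_sym.
- exact: same_s_del IH disk isoL.
exact: same_s_add IH disl isoK.
Qed.

Lemma same_s_refl G : same_s_homotopy_type G G.
Proof. exact/same_s_iso/graph_iso_refl. Qed.

Lemma same_s_sym G H : same_s_homotopy_type G H -> same_s_homotopy_type H G.
Proof.
elim=> {H} [H GH|H K h _ IH dish isoK|H K k _ IH disk isoH].
- exact/same_s_iso/graph_iso_sym.
- by apply: same_s_trans IH; apply: same_s_add (same_s_refl _) dish isoK.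
by apply: same_s_trans IH; apply: same_s_del (same_s_refl _) disk isoH.
Qed.

Lemma collapses_same_s G (A B : {set G}) :
    collapses (@s_dismantlable_in G) A B ->
  same_s_homotopy_type (induced A) (induced B).
Proof.
elim=> {A B} [A|A B a aA disa _]; first exact: same_s_refl.
apply: same_s_trans; pose a' : induced A := exist _ a aA.
apply: (same_s_del (h := a')); first exact: same_s_refl.
  (* [val] maps the full vertex set of [induced A] onto [A], so the relative condition in [G] is
     reflected to an absolute one in [induced A]. *)
  apply: (@s_dismantlable_reflect (induced A) G val) => //; first exact: val_inj.
  congr (graph_dismantlable (open_nbhd _ _)): disa.
  apply/setP=> x; apply/idP/imsetP => [xA|[y _ ->]]; last exact: valP y.
  by exists (exist _ x xA).
apply: (@induced_iso (del_vertex a') G (fun x => val (val x)) (A :\ a)) => //.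
- by move=> x y /val_inj/val_inj.
- by move=> x; rewrite inE (valP (val x)) andbT; have := valP x; rewrite !inE.
move=> y; rewrite !inE => /andP[neq_ya yA].
pose y' : induced A := exist _ y yA.
have y'P : y' \in [set~ a'] by rewrite !inE.
by exists (exist (fun z => z \in [set~ a']) y' y'P).
Qed.

Lemma collapses_same_s_setT G (B : {set G}) :
    collapses (@s_dismantlable_in G) [set: G] B ->
  same_s_homotopy_type G (induced B).
Proof.
move/collapses_same_s; apply: same_s_trans; apply: same_s_iso.
by apply: (@induced_iso _ _ id) => // y _; exists y.
Qed.

(** * Cones, dominated vertices and joins of graphs *)

Lemma graph_cone_dismantlable G (A : {set G}) (c : G) :
    c \in A -> {in A, forall x, x != c -> adj x c} -> graph_dismantlable A.
Proof.
move=> cA adjc; have sub : A :\ c \subset A by apply: subsetDl.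
apply: (@collapses_dismantlable _ _ _ (A :\: (A :\ c))); last first.
  have -> : A :\: (A :\ c) = [set c]; last exact: dismantlable_by1.
  by apply/setP=> x; rewrite !inE; case: eqVneq => [->|] //=; case: (x \in A).
(* The rank is constant because order is irrelevant: as long as the cone point [c] remains, it
   dominates every other vertex. *)
apply: (@collapses_ranked _ _ (fun=> 0)) => // B x sB sBA xB.
rewrite !inE => /andP[neq_xc xA] _; exists c; split=> //; last 1 first.
- apply/subsetP=> y; rewrite !inE => /predU1P [->|/andP[yB _]].
    by rewrite (negPf neq_xc) xB adj_sym adjc.
  by case: eqVneq => //= neq_yc; rewrite yB adj_sym adjc // (subsetP sBA).
- by apply: (subsetP sB); rewrite !inE eqxx cA.
by rewrite eq_sym.
Qed.

(** A vertex dominating [x] is a cone point of the neighbourhood of [x]. *)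
Lemma dominated_s_dismantlable G (A : {set G}) (x : G) :
  dominated_in A x -> s_dismantlable_in A x.
Proof.
case=> c [cA neq_cx sub]; have dom y : y \in A -> adj x y -> y != c -> adj c y.
  move=> yA xy neq_yc; have /subsetP/(_ y) := sub.
  by rewrite !inE yA xy orbT (negPf neq_yc) => /(_ isT).
apply: (@graph_cone_dismantlable _ _ c) => [|y].
  rewrite inE cA; have /subsetP/(_ x) := sub.
  by rewrite !inE eqxx eq_sym (negPf neq_cx) adj_sym => /(_ isT)/andP[].
by rewrite inE => /andP[yA xy] neq_yc; rewrite adj_sym dom.
Qed.

(** A dismantling of [L] can be performed with [U] present, since all vertices of [L] have the same
    neighbours in [U]. The last vertex of [L] is then a cone point over [U]. *)
Lemma graph_join_dismantlable G (L U : {set G}) :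
    {in L & U, forall x y, adj x y} ->
  graph_dismantlable L -> graph_dismantlable (L :|: U).
Proof.
move=> LU dis; elim/dismantlable_by_rect: L / dis LU => [x LU|L x xL domx _ IH LU].
  apply: (@graph_cone_dismantlable _ _ x); first by rewrite !inE eqxx.
  move=> y; rewrite !inE => /orP[->//|yU] _.
  by rewrite adj_sym LU ?inE.
have xU : x \notin U by apply/negP=> /(LU x x xL); rewrite adj_irrefl.
apply: (dismantlable_byS (x := x)); first by rewrite inE xL.
  case: domx => y [yL neq_yx sub]; exists y; split=> //; first by rewrite inE yL.
  apply/subsetP=> z; rewrite !inE andb_orl.
  have /subsetP/(_ z) := sub; rewrite !inE.
  case: (z \in U) / idP => [zU|_]; first by rewrite LU ?LU // !orbT.
  by rewrite /= !orbF.
have -> : (L :|: U) :\ x = L :\ x :|: U.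
  by apply/setP=> y; rewrite !inE; case: eqVneq => [->|] //=; rewrite (negPf xU).
by apply: IH => y z; rewrite inE => /andP[_ yL]; apply: LU.
Qed.

End Graphs.

(** * Posets *)

Section Posets.
Local Open Scope order_scope.

Lemma poset_iso_refl d (P : finPOrderType d) : poset_iso P P.
Proof. by exists id => //; exists id. Qed.

Lemma poset_iso_sym d (P : finPOrderType d) d' (Q : finPOrderType d') :
  poset_iso P Q -> poset_iso Q P.
Proof.
case=> f [g fK gK] f_le; exists g; first by exists f.
by move=> x y; rewrite -f_le !gK.
Qed.

Lemma poset_iso_trans d (P : finPOrderType d) d' (Q : finPOrderType d')
    d'' (R : finPOrderType d'') :
  poset_iso P Q -> poset_iso Q R -> poset_iso P R.
Proof.
case=> f f_bij f_le [g g_bij g_le]; exists (g \o f); first exact: bij_comp.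
by move=> x y; rewrite /= g_le f_le.
Qed.

Lemma subposet_iso d (P : finPOrderType d) d' (Q : finPOrderType d')
    (f : P -> Q) (B : {set Q}) :
    {mono f : x y / x <= y} ->
    (forall x, f x \in B) -> (forall y, y \in B -> exists x, f x = y) ->
  poset_iso P (subposet B).
Proof.
move=> f_le fB f_surj; have f_inj := inc_inj f_le.
exists (fun x => exist _ (f x) (fB x) : subposet B) => [|x y]; last exact: f_le.
apply: inj_card_bij => [x y [/f_inj]//|].
rewrite card_sig -(card_imset _ f_inj); apply: subset_leq_card.
by apply/subsetP=> y /f_surj [x <-]; apply: imset_f.
Qed.

Lemma below_imset d (P : finPOrderType d) d' (Q : finPOrderType d')
    (f : P -> Q) (A : {set P}) (x : P) :
  {mono f : x y / x <= y} -> below (f @: A) (f x) = f @: below A x.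
Proof.
move=> f_le; apply/setP=> y; rewrite inE.
apply/andP/imsetP => [[/imsetP [z zA ->]]|[z]].
  by rewrite (leW_mono f_le) => xz; exists z; rewrite ?inE ?zA.
by rewrite inE => /andP[zA xz] ->; rewrite (leW_mono f_le) imset_f.
Qed.

Lemma above_imset d (P : finPOrderType d) d' (Q : finPOrderType d')
    (f : P -> Q) (A : {set P}) (x : P) :
  {mono f : x y / x <= y} -> above (f @: A) (f x) = f @: above A x.
Proof.
move=> f_le; apply/setP=> y; rewrite inE.
apply/andP/imsetP => [[/imsetP [z zA ->]]|[z]].
  by rewrite (leW_mono f_le) => xz; exists z; rewrite ?inE ?zA.
by rewrite inE => /andP[zA xz] ->; rewrite (leW_mono f_le) imset_f.
Qed.

Lemma poset_dismantlable_reflect d (P : finPOrderType d)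
    d' (Q : finPOrderType d') (f : P -> Q) (A : {set P}) :
    {mono f : x y / x <= y} ->
  poset_dismantlable (f @: A) -> poset_dismantlable A.
Proof.
move=> f_le; apply: dismantlable_by_reflect => [|{}A x xA].
  exact: inc_inj f_le.
rewrite /irreducible_in below_imset // above_imset //.
case=> -[_ /imsetP [m mA ->] ext]; [left | right]; exists m => // y yA;
  by rewrite -f_le ext ?imset_f.
Qed.

Definition weak_in d (P : finPOrderType d) (A : {set P}) (x : P) : Prop :=
  poset_dismantlable (below A x) \/ poset_dismantlable (above A x).

Lemma weak_in_reflect d (P : finPOrderType d) d' (Q : finPOrderType d')
    (f : P -> Q) (A : {set P}) (x : P) :
  {mono f : x y / x <= y} -> weak_in (f @: A) (f x) -> weak_in A x.
Proof.
move=> f_le; rewrite /weak_in below_imset // above_imset //.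
by case=> /(poset_dismantlable_reflect f_le); [left | right].
Qed.

Lemma weak_point_iso d (P : finPOrderType d) d' (Q : finPOrderType d') (x : P) :
    poset_iso P Q -> weak_point x ->
  exists2 y : Q, weak_point y & poset_iso (del_point x) (del_point y).
Proof.
case=> f [f' fK f'K] f_le weak; have f_inj := can_inj fK.
exists (f x).
  apply: (weak_in_reflect (f := f')) => [y z|]; first by rewrite -f_le !f'K.
  rewrite fK; congr (weak_in _ _): weak.
  by apply/setP=> y; rewrite -{2}[y]fK inE imset_f ?inE.
apply: (@subposet_iso _ (del_point x) _ Q (fun y => f (val y)) [set~ f x]).
- by move=> y z; rewrite f_le.
- by move=> y; rewrite inE in_set1 (inj_eq f_inj); have := valP y; rewrite !inE.
move=> y y_neq; have f'y : f' y \in [set~ x].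
  by move: y_neq; rewrite !inE; apply: contraNneq => <-; rewrite f'K.
by exists (exist _ (f' y) f'y : del_point x); rewrite /= f'K.
Qed.

Lemma simply_refl d (P : finPOrderType d) : simply_equivalent P P.
Proof. exact/simply_iso/poset_iso_refl. Qed.

(** As for graphs, the isomorphism opening the second chain is absorbed into the last step of the
    first. *)
Lemma simply_trans d (P : finPOrderType d) d' (Q : finPOrderType d')
    d'' (R : finPOrderType d'') :
  simply_equivalent P Q -> simply_equivalent Q R -> simply_equivalent P R.
Proof.
move=> PQ; elim=> {d'' R}
  [d'' R QR|d'' S e R s _ IH weaks isoR|d'' S e R r _ IH weakr isoS].
- case: PQ QR => {d' Q}
    [d' Q PQ|d' S e Q s PS weaks isoQ|d' S e Q q PS weakq isoS] QR.
  + by apply: simply_iso; apply: poset_iso_trans QR.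
  + by apply: simply_del PS weaks _; apply: poset_iso_trans QR.
  have [r weakr iso_del] := weak_point_iso QR weakq.
  apply: simply_add PS weakr _; apply: poset_iso_trans isoS.
  exact: poset_iso_sym.
- exact: simply_del IH weaks isoR.
exact: simply_add IH weakr isoS.
Qed.

Lemma simply_sym d (P : finPOrderType d) d' (Q : finPOrderType d') :
  simply_equivalent P Q -> simply_equivalent Q P.
Proof.
elim=> {d' Q} [d' Q PQ|d' Q e R q _ IH weakq isoR|d' Q e R r _ IH weakr isoQ].
- exact/simply_iso/poset_iso_sym.
- by apply: simply_trans IH; apply: simply_add (simply_refl _) weakq isoR.
by apply: simply_trans IH; apply: simply_del (simply_refl _) weakr isoQ.
Qed.

Section OnePoset.
Variables (d : Order.disp_t) (P : finPOrderType d).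
Implicit Types (A B : {set P}) (x y m : P).

Lemma collapses_simply A B :
    collapses (@weak_in _ P) A B ->
  simply_equivalent (subposet A) (subposet B).
Proof.
elim=> {A B} [A|A B a aA weaka _]; first exact: simply_refl.
apply: simply_trans; pose a' : subposet A := exist _ a aA.
apply: (simply_del (q := a')); first exact: simply_refl.
  apply: (@weak_in_reflect _ (subposet A) _ P val) => //.
  congr (weak_in _ _): weaka.
  apply/setP=> x; apply/idP/imsetP => [xA|[y _ ->]]; last exact: valP y.
  by exists (exist _ x xA).
apply: (@subposet_iso _ (del_point a') _ P
  (fun y : {y : subposet A | y \in [set~ a']} => val (val y)) (A :\ a)) => //.
- by move=> x; rewrite inE (valP (val x)) andbT; have := valP x; rewrite !inE.
move=> y; rewrite !inE => /andP[neq_ya yA].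
pose y' : subposet A := exist _ y yA.
have y'P : y' \in [set~ a'] by rewrite !inE.
by exists (exist (fun z => z \in [set~ a']) y' y'P).
Qed.

Lemma collapses_simply_setT B :
  collapses (@weak_in _ P) [set: P] B -> simply_equivalent P (subposet B).
Proof.
move/collapses_simply; apply: simply_trans; apply: simply_iso.
by apply: (@subposet_iso _ P _ P id) => // y _; exists y.
Qed.

(** * Extrema, irreducible points, and their images in the comparability graph *)

Lemma card_below_lt A x y : x \in A -> x < y -> (#|below A x| < #|below A y|)%N.
Proof.
move=> xA xy; apply: proper_card; apply/properP; split.
  by apply/subsetP=> z; rewrite !inE => /andP[-> /lt_trans->].
by exists x; rewrite !inE ?xA ?ltxx ?andbF.
Qed.

Lemma has_minimum_dismantlable A : has_minimum A -> poset_dismantlable A.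
Proof.
case=> m mA minm.
apply: (@collapses_dismantlable _ _ _ (A :\: (A :\ m))); last first.
  have -> : A :\: (A :\ m) = [set m]; last exact: dismantlable_by1.
  by apply/setP=> x; rewrite !inE; case: eqVneq => [->|] //=; case: (x \in A).
(* Points are removed from the bottom up, so that only [m] remains below the point being removed. *)
apply: (@collapses_ranked _ _ (fun x => #|below A x|)); first exact: subsetDl.
move=> B x sB sBA xB; rewrite !inE => /andP[neq_xm xA] minx.
left; exists m.
  rewrite inE lt_neqAle eq_sym neq_xm minm // !andbT.
  by apply: (subsetP sB); rewrite !inE eqxx mA.
move=> y; rewrite inE => /andP[yB yx]; apply: contraTT isT => not_ym.
have yA := subsetP sBA _ yB.
have /minx : y \in B by [].
rewrite !inE yA andbT leqNgt card_below_lt // => -> //.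
by apply: contraNneq not_ym => ->.
Qed.

Lemma has_maximum_dismantlable A : has_maximum A -> poset_dismantlable A.
Proof.
case=> m mA maxm.
apply: (@collapses_dismantlable _ _ _ (A :\: (A :\ m))); last first.
  have -> : A :\: (A :\ m) = [set m]; last exact: dismantlable_by1.
  by apply/setP=> x; rewrite !inE; case: eqVneq => [->|] //=; case: (x \in A).
(* This rank decreases along the order: points are removed from the top down, so that only [m]
   remains above the current one. *)
apply: (@collapses_ranked _ _ (fun x => #|A :\: below A x|)) => [|B x sB sBA xB].
  exact: subsetDl.
rewrite !inE => /andP[neq_xm xA] minx; right; exists m.
  rewrite inE lt_neqAle neq_xm maxm // !andbT.
  by apply: (subsetP sB); rewrite !inE eqxx mA.
move=> y; rewrite inE => /andP[yB xy]; apply: contraTT isT => not_my.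
have yA := subsetP sBA _ yB.
have sub z : below A z \subset A by apply/subsetP=> u; rewrite inE => /andP[].
have /minx : y \in B by [].
rewrite !inE yA andbT !cardsDS // leqNgt.
rewrite ltn_sub2l ?card_below_lt //; last first.
  by apply: leq_trans (card_below_lt xA xy) (subset_leq_card (sub y)).
by move=> -> //; apply: contraNneq not_my => ->.
Qed.

Lemma irreducible_weak A x : irreducible_in A x -> weak_in A x.
Proof.
case=> [/has_maximum_dismantlable|/has_minimum_dismantlable]; by [left | right].
Qed.

(** If [m] is the maximum below [x], every point comparable to [x] is comparable to [m]: those above
    [x] are above [m], those below [x] are at most [m]. So [m] dominates [x]; the minimum above [x]
    is treated dually. *)
Lemma poset_dismantlable_Comp A :
  poset_dismantlable A -> @graph_dismantlable (Comp P) A.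
Proof.
apply: dismantlable_by_sub => {}A x xA [] [m].
  rewrite inE => /andP[mA mx] maxm; exists m; split; rewrite ?(lt_eqF mx) //.
  apply/subsetP=> y; rewrite !inE => /predU1P [->|/and3P[yA neq_xy]].
    by rewrite xA adj_sym; apply/orP; right; rewrite /adj /= (gt_eqF mx) ge_comparable ?ltW.
  rewrite yA /= /adj /=; case: eqVneq => //= neq_ym.
  case/orP=> [xy|yx]; first by rewrite le_comparable // (le_trans (ltW mx)).
  by rewrite ge_comparable // maxm // inE yA lt_neqAle eq_sym neq_xy.
rewrite inE => /andP[mA xm] minm; exists m; split; rewrite ?(gt_eqF xm) //.
apply/subsetP=> y; rewrite !inE => /predU1P [->|/and3P[yA neq_xy]].
  by rewrite xA adj_sym; apply/orP; right; rewrite /adj /= (lt_eqF xm) le_comparable ?ltW.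
rewrite yA /= /adj /=; case: eqVneq => //= neq_ym.
case/orP=> [xy|yx]; last by rewrite ge_comparable // (le_trans yx (ltW xm)).
by rewrite le_comparable // minm // inE yA lt_neqAle neq_xy.
Qed.

Lemma weak_point_s_dismantlable x :
  weak_point x -> s_dismantlable (x : Comp P).
Proof.
have nbhd : @open_nbhd (Comp P) [set: P] x
    = below [set: P] x :|: above [set: P] x.
  apply/setP=> y; rewrite !inE /= /adj /= /Order.comparable !lt_neqAle eq_sym.
  by case: eqVneq => //= _; rewrite orbC.
have adj_ba : {in below [set: P] x & above [set: P] x,
    forall y z, @adj (Comp P) y z}.
  move=> y z; rewrite !inE /= => yx xz; have yz := lt_trans yx xz.
  by rewrite /adj /= lt_eqF // le_comparable // ltW.
rewrite /s_dismantlable nbhd.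
case=> /poset_dismantlable_Comp; first exact: graph_join_dismantlable.
rewrite setUC; apply: graph_join_dismantlable => y z yA zB.
by rewrite adj_sym adj_ba.
Qed.

End OnePoset.

(** * Passage of simple equivalences to comparability graphs *)

Lemma poset_iso_Comp d (P : finPOrderType d) d' (Q : finPOrderType d') :
  poset_iso P Q -> graph_iso (Comp P) (Comp Q).
Proof.
case=> f f_bij f_le; exists f => // x y.
by rewrite /adj /= /Order.comparable !f_le (inj_eq (bij_inj f_bij)).
Qed.

Lemma del_point_Comp d (P : finPOrderType d) (x : P) :
  graph_iso (del_vertex (x : Comp P)) (Comp (del_point x)).
Proof. by exists id; first by exists id. Qed.

Lemma simply_equivalent_Comp d (P : finPOrderType d) d' (Q : finPOrderType d') :
  simply_equivalent P Q -> same_s_homotopy_type (Comp P) (Comp Q).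
Proof.
elim=> {d' Q} [d' Q PQ|d' Q e R q _ IH weakq isoR|d' Q e R r _ IH weakr isoQ].
- exact/same_s_iso/poset_iso_Comp.
- apply: same_s_del IH (weak_point_s_dismantlable weakq) _.
  by apply: graph_iso_trans (del_point_Comp q) _; apply: poset_iso_Comp.
apply: same_s_add IH (weak_point_s_dismantlable weakr) _.
by apply: graph_iso_trans (del_point_Comp r) _; apply: poset_iso_Comp.
Qed.

End Posets.

(** * Clique posets *)

Section Cliques.
Variable G : sgraph.
Implicit Types (A S Z : {set G}) (a b g : G) (s t u : C G) (K D : {set C G}).

Definition clique_set s : {set G} := val (s : complete_subgraph G).

Lemma clique_set_inj : injective clique_set. Proof. exact: val_inj. Qed.

Lemma clique_leE s t : (s <= t)%O = (clique_set s \subset clique_set t).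
Proof. by []. Qed.

Lemma clique_ltE s t : (s < t)%O = (clique_set s \proper clique_set t).
Proof.
by rewrite lt_neqAle clique_leE properEneq (inj_eq clique_set_inj).
Qed.

Lemma is_completeP A :
  reflect {in A &, forall x y, x != y -> adj x y} (is_complete A).
Proof.
apply: (iffP forall_inP) => [cA x y xA yA neq_xy|cA x xA].
  by have /forall_inP/(_ y yA)/implyP/(_ neq_xy) := cA x xA.
by apply/forall_inP=> y yA; apply/implyP; apply: cA.
Qed.

Lemma clique_complete s :
  {in clique_set s &, forall x y, x != y -> adj x y}.
Proof. by apply/is_completeP; case/andP: (valP (s : complete_subgraph G)). Qed.

Lemma clique_neq0 s : clique_set s != set0.
Proof. by case/andP: (valP (s : complete_subgraph G)). Qed.

Lemma cliqueP A a : a \in A -> is_complete A -> exists s, clique_set s = A.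
Proof.
move=> aA cA; have A_ok : (A != set0) && is_complete A.
  by rewrite cA andbT; apply/set0Pn; exists a.
by exists (exist _ A A_ok : complete_subgraph G).
Qed.

Lemma clique1 a : exists s, clique_set s = [set a].
Proof.
apply: (cliqueP (a := a)); rewrite ?set11 //; apply/is_completeP=> x y.
by rewrite !inE => /eqP-> /eqP->; rewrite eqxx.
Qed.

(** * Changing cliques by one vertex, and dismantling of clique posets *)

Lemma complete_setU1 A b :
    is_complete A -> {in A, forall x, x != b -> adj x b} ->
  is_complete (b |: A).
Proof.
move=> /is_completeP cA adjb; apply/is_completeP=> x y.
rewrite !inE => /predU1P [->|xA] /predU1P [->|yA] neq_xy.
- by rewrite eqxx in neq_xy.
- by rewrite adj_sym adjb // eq_sym.
- exact: adjb.
exact: cA.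
Qed.

Lemma clique_setU1 s b :
    {in clique_set s, forall x, x != b -> adj x b} ->
  exists t, clique_set t = b |: clique_set s.
Proof.
move=> adjb; apply: (cliqueP (a := b)); first by rewrite !inE eqxx.
by apply: complete_setU1 => //; apply/is_completeP/clique_complete.
Qed.

Lemma clique_setD1 s a b :
  b \in clique_set s -> b != a -> exists t, clique_set t = clique_set s :\ a.
Proof.
move=> bs neq_ba; apply: (cliqueP (a := b)); first by rewrite !inE neq_ba.
apply/is_completeP=> x y; rewrite !inE => /andP[_ xs] /andP[_ ys].
exact: (clique_complete xs ys).
Qed.

(** Largest cliques go first. What is left above [s] then lies outside [D], hence contains [b], so
    [b |: s] is the minimum above [s]. *)
Lemma collapses_setU1 K D b :
    D \subset K ->
    (forall s, s \in D -> b \notin clique_set s) ->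
    (forall s, s \in D ->
       exists2 t, t \in K :\: D & clique_set t = b |: clique_set s) ->
    (forall s u, s \in D -> u \in K :\: D -> (s < u)%O -> b \in clique_set u) ->
  collapses (@irreducible_in _ (C G)) K (K :\: D).
Proof.
move=> sDK bD addb memb.
apply: (@collapses_ranked _ _ (fun s => #|~: clique_set s|)) => //.
move=> B s sB sBK sinB sD mins; right.
have [t tKD def_t] := addb s sD; exists t.
  rewrite inE (subsetP sB) // clique_ltE def_t properE subsetUr.
  by apply/subsetPn; exists b; rewrite ?inE ?eqxx ?bD.
move=> u; rewrite inE => /andP[uB su]; have uD : u \notin D.
  apply/negP=> /(mins u uB); apply/negP; rewrite -ltnNge proper_card //.
  by rewrite properC -clique_ltE.
rewrite clique_leE def_t subUset sub1set (memb s) ?inE ?uD ?(subsetP sBK) //.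
by rewrite -clique_leE ltW.
Qed.

(** Smallest cliques go first. What is left below [s] then avoids [a], so [s :\ a] is the maximum
    below [s]. *)
Lemma collapses_setD1 K D a :
    D \subset K ->
    (forall s, s \in D -> a \in clique_set s) ->
    (forall s, s \in D ->
       exists2 t, t \in K :\: D & clique_set t = clique_set s :\ a) ->
    (forall s u, s \in D -> u \in K :\: D -> (u < s)%O -> a \notin clique_set u) ->
  collapses (@irreducible_in _ (C G)) K (K :\: D).
Proof.
move=> sDK aD dela nmema.
apply: (@collapses_ranked _ _ (fun s => #|clique_set s|)) => //.
move=> B s sB sBK sinB sD mins; left.
have [t tKD def_t] := dela s sD; exists t.
  by rewrite inE (subsetP sB) // clique_ltE def_t properD1 ?aD.
move=> u; rewrite inE => /andP[uB us]; have uD : u \notin D.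
  by apply/negP=> /(mins u uB); apply/negP; rewrite -ltnNge proper_card //.
rewrite clique_leE def_t subsetD1 (nmema s) ?inE ?uD ?(subsetP sBK) //.
by rewrite -clique_leE ltW.
Qed.

(* For a complete Z joined to all of A: the cliques Z |: s, with s a nonempty
   clique of A. *)
Definition cliques_over Z A : {set C G} :=
  [set s : C G | [&& Z \subset clique_set s, clique_set s \subset Z :|: A
                  & ~~ (clique_set s \subset Z)]].

(** Induction along a dismantling of [A]. If [b] dominates [a], cliques through [a] missing [b] are
    removed by adding [b], then those through both by dropping [a]; the cliques over [A :\ a]
    remain. For one vertex [a], the only clique is [a |: Z]. *)
Lemma cliques_over_dismantlable Z A :
    is_complete Z -> {in Z & A, forall x y, adj x y} ->
  graph_dismantlable A -> poset_dismantlable (cliques_over Z A).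
Proof.
move=> cZ ZA dis; elim/dismantlable_by_rect: A / dis ZA => [a|A a aA doma _ IH] ZA.
  have aZ : a \notin Z.
    by apply/negP=> /ZA/(_ (set11 a)); rewrite adj_irrefl.
  have [t def_t] : exists t, clique_set t = a |: Z.
    apply: (cliqueP (a := a)); first by rewrite !inE eqxx.
    by apply: complete_setU1 => // x xZ _; apply: ZA; rewrite ?set11.
  have -> : cliques_over Z [set a] = [set t]; last exact: dismantlable_by1.
  apply/setP=> s; rewrite !inE -(inj_eq clique_set_inj) def_t.
  apply/and3P/eqP => [[sZs ssZa /subsetPn [x xs xZ]]|->]; last first.
    by split; rewrite ?subsetUr // setUC ?subxx // subUset sub1set (negPf aZ) andbF.
  apply/eqP; rewrite eqEsubset setUC ssZa subUset sZs sub1set.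
  by have := subsetP ssZa _ xs; rewrite !inE (negPf xZ) => /eqP <-.
have AZ x : x \in A -> x \notin Z.
  by move=> xA; apply/negP=> /ZA/(_ xA); rewrite adj_irrefl.
case: doma => b [bA neq_ba sub].
have ab : adj a b.
  have /subsetP/(_ a) := sub; rewrite !inE eqxx eq_sym (negPf neq_ba).
  by rewrite adj_sym => /(_ isT)/andP[].
pose K := cliques_over Z A.
pose D1 := [set s in K | (a \in clique_set s) && (b \notin clique_set s)].
pose D2 := [set s in K | (a \in clique_set s) && (b \in clique_set s)].
apply: (@collapses_dismantlable _ _ _ (K :\: D1)).
  apply: (@collapses_setU1 _ _ b).
  - by apply/subsetP=> s; rewrite inE => /andP[].
  - by move=> s; rewrite inE => /and3P[].
  - move=> s; rewrite !inE => /and3P[/and3P[sZs ssZA _] as_ bs].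
    (* [b |: s] is a clique: vertices of [Z] are joined to all of [A], and the others lie in the
       closed neighbourhood of [a], hence in that of [b]. *)
    have [|t def_t] := @clique_setU1 s b.
      move=> x xs neq_xb.
      have := subsetP ssZA _ xs; rewrite inE => /orP[xZ|xA]; first exact: ZA.
      have [->//|neq_xa] := eqVneq x a.
      have /subsetP/(_ x) := sub.
      rewrite !inE xA (negPf neq_xb) (negPf neq_xa) /= adj_sym.
      by rewrite (clique_complete xs as_) // adj_sym; apply.
    exists t => //; rewrite !inE def_t !inE eqxx !andbF /=.
    rewrite (subset_trans sZs) ?subsetUr //= !subUset !sub1set ssZA !inE bA.
    by rewrite orbT (negPf (AZ _ bA)).
  move=> s u; rewrite !inE => /and3P[_ as_ _] /andP[+ uK] su.
  have au : a \in clique_set u by apply: (subsetP _ _ as_); rewrite -clique_leE ltW.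
  by rewrite uK au /= negbK.
apply: (@collapses_dismantlable _ _ _ ((K :\: D1) :\: D2)).
  apply: (@collapses_setD1 _ _ a).
  - by apply/subsetP=> s; rewrite !inE => /and3P[-> -> ->].
  - by move=> s; rewrite inE => /and3P[].
  - move=> s; rewrite !inE => /and3P[/and3P[sZs ssZA _] as_ bs].
    (* Dropping [a] leaves [b], which is outside [Z], so the result is still a clique over [A]. *)
    have [t def_t] := clique_setD1 bs neq_ba; exists t => //.
    rewrite !inE def_t !inE eqxx !andbF /=.
    rewrite subsetD1 sZs AZ //= (subset_trans _ ssZA) ?subsetDl //=.
    by apply/subsetPn; exists b; rewrite ?AZ // !inE neq_ba.
  move=> s u _; rewrite !inE => /and3P[+ + uK] _; rewrite uK /=.
  by case: (a \in _); case: (b \in _).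
have -> : K :\: D1 :\: D2 = cliques_over Z (A :\ a).
  have eqZA : Z :|: A :\ a = (Z :|: A) :\ a.
    by apply/setP=> x; rewrite !inE; case: eqVneq => [->|] //=; rewrite (negPf (AZ _ aA)).
  apply/setP=> s; rewrite [RHS]inE eqZA subsetD1 !inE.
  by do ![case: (_ \subset _) | case: (_ \in _)].
by apply: IH => x y xZ; rewrite inE => /andP[_]; apply: ZA.
Qed.

End Cliques.

(** * Passage of s-homotopies to clique posets *)

Lemma is_complete_imset (G H : sgraph) (f : G -> H) (A : {set G}) :
  {mono f : x y / adj x y} -> is_complete A -> is_complete (f @: A).
Proof.
move=> f_adj /is_completeP cA; apply/is_completeP=> _ _ /imsetP [x xA ->] /imsetP [y yA ->].
by move=> neq_fxy; rewrite f_adj cA //; apply: contraNneq neq_fxy => ->.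
Qed.

(** An embedding preserves and reflects adjacency, so images and preimages of cliques are cliques.
    This serves both for isomorphisms and for the inclusion of a graph with one vertex deleted. *)
Lemma clique_poset_embedding (G H : sgraph) (f : G -> H) :
    injective f -> {mono f : x y / adj x y} ->
  poset_iso (C G)
    (subposet [set s : C H | clique_set s \subset f @: [set: G]]).
Proof.
move=> f_inj f_adj.
have fs_ok (s : C G) : (f @: clique_set s != set0) && is_complete (f @: clique_set s).
  rewrite imset_eq0 clique_neq0 is_complete_imset //.
  exact/is_completeP/clique_complete.
pose fs (s : C G) : C H :=
  exist (fun A : {set H} => (A != set0) && is_complete A) _ (fs_ok s).
apply: (@subposet_iso _ (C G) _ (C H) fs) => [s t|s|t].
- rewrite !clique_leE; apply/subsetP/subsetP => [sub x xs|sub _ /imsetP [x xs ->]].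
    by have := sub (f x); rewrite !mem_imset //; apply.
  by rewrite imset_f ?sub.
- by rewrite inE; apply/subsetP=> _ /imsetP [x _ ->]; rewrite imset_f ?inE.
rewrite inE => sub; have [y yt] := set0Pn _ (clique_neq0 t).
have /imsetP [x _ def_y] := subsetP sub _ yt.
have [||s def_s] := @cliqueP _ [set x | f x \in clique_set t] x.
- by rewrite inE -def_y.
- apply/is_completeP=> u v; rewrite !inE => ut vt neq_uv; rewrite -f_adj.
  by apply: (clique_complete ut vt); rewrite inj_eq.
exists s; apply: clique_set_inj; rewrite /fs {1}/clique_set /= def_s.
apply/setP=> z; apply/imsetP/idP => [[u]|zt]; first by rewrite inE => ut ->.
have /imsetP [u _ def_z] := subsetP sub _ zt.
by exists u; rewrite // inE -def_z.
Qed.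

Lemma clique_poset_iso (G H : sgraph) : graph_iso G H -> poset_iso (C G) (C H).
Proof.
case=> f f_bij f_adj.
apply: poset_iso_trans (clique_poset_embedding (bij_inj f_bij) f_adj) _.
apply: poset_iso_sym; apply: (@subposet_iso _ (C H) _ (C H) id) => // [s|t _].
  rewrite inE; apply/subsetP=> y _; case: f_bij => g _ gK.
  by rewrite -(gK y) imset_f ?inE.
by exists t.
Qed.

Lemma collapses_star (G : sgraph) (g : G) :
    s_dismantlable g ->
  collapses (@weak_in _ (C G)) [set: C G] [set s | g \notin clique_set s].
Proof.
move=> dis; have [t def_t] := clique1 g.
apply: (collapses_step (x := t)); first by rewrite inE.
  (* A clique strictly above [{g}] consists of [g] and a nonempty clique of neighbours of [g]. *)
  right; have <- : cliques_over [set g] (open_nbhd [set: G] g) = above [set: C G] t.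
    apply/setP=> s; rewrite !inE clique_ltE properE def_t sub1set.
    case: (boolP (g \in clique_set s)) => //= gs.
    have -> // : clique_set s \subset g |: open_nbhd [set: G] g.
    apply/subsetP=> x xs; rewrite !inE /=; have [//|neq_xg] := eqVneq x g.
    by rewrite (clique_complete gs xs) // eq_sym.
  apply: cliques_over_dismantlable => // [|x y].
    by rewrite -def_t; apply/is_completeP/clique_complete.
  by rewrite !inE => /eqP-> /andP[].
have -> : [set s | g \notin clique_set s] =
   ([set: C G] :\ t) :\: [set s in [set: C G] :\ t | g \in clique_set s].
  apply/setP=> s; rewrite !inE; case: eqVneq => [->|] //=.
    by rewrite def_t set11.
  by rewrite andbT.
apply: collapses_sub (fun A x _ => @irreducible_weak _ _ A x) _.
apply: (@collapses_setD1 _ _ _ g).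
- by apply/subsetP=> s; rewrite inE => /andP[].
- by move=> s; rewrite inE => /andP[].
- move=> s; rewrite !inE andbT => /andP[neq_st gs].
  (* As [{g}] is already gone, [s] has a second vertex, and dropping [g] leaves a nonempty
     clique. *)
  have /subsetPn [b bs] : ~~ (clique_set s \subset [set g]).
    apply: contra neq_st => sub; rewrite -(inj_eq (@clique_set_inj G)) def_t.
    by rewrite eqEsubset sub sub1set.
  rewrite inE => neq_bg; have [u def_u] := clique_setD1 bs neq_bg.
  exists u => //; rewrite !inE def_u setD11 andbF /= andbT.
  apply: contraTneq (set11 g) => eq_ut; rewrite -def_t -eq_ut def_u.
  by rewrite setD11.
by move=> s u _; rewrite !inE andbT negb_and; case: (u =P t) => //= _; rewrite andbT.
Qed.

Lemma s_dismantlable_clique_poset (G : sgraph) (g : G) :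
  s_dismantlable g -> simply_equivalent (C G) (C (del_vertex g)).
Proof.
move/collapses_star/collapses_simply_setT => simplyC; apply: simply_trans simplyC _.
apply/simply_iso/poset_iso_sym.
have -> : [set s | g \notin clique_set s] =
    [set s : C G | clique_set s \subset val @: [set: del_vertex g]].
  apply/setP=> s; rewrite !inE.
  apply/idP/subsetP => [gs x xs|sub]; last first.
    apply/negP=> /sub/imsetP [x _ def_g]; have := valP x.
    by rewrite -def_g !inE eqxx.
  have x' : x \in [set~ g] by rewrite !inE; apply: contraNneq gs => <-.
  by apply/imsetP; exists (exist (fun y => y \in [set~ g]) x x').
by apply: (@clique_poset_embedding (del_vertex g) G val) => //; apply: val_inj.
Qed.

Lemma same_s_homotopy_type_C (G H : sgraph) :
  same_s_homotopy_type G H -> simply_equivalent (C G) (C H).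
Proof.
elim=> {H} [H GH|H K h _ IH dish isoK|H K k _ IH disk isoH].
- exact/simply_iso/clique_poset_iso.
- apply: simply_trans IH _.
  apply: simply_trans (s_dismantlable_clique_poset dish) _.
  exact/simply_iso/clique_poset_iso.
apply: simply_trans IH _; apply: simply_sym.
apply: simply_trans (s_dismantlable_clique_poset disk) _.
exact/simply_iso/clique_poset_iso.
Qed.

(** * Cylinders *)

Section CylinderGraph.
Variable G : sgraph.

(* A vertex [a] is joined to a clique [s] when [s] together with [a] is a clique. *)
Definition graph_cylinder_adj : rel (G + C G) := fun x y =>
  match x, y with
  | inl a, inl b => adj a b
  | inl a, inr s | inr s, inl a => clique_set s \subset closed_nbhd [set: G] a
  | inr s, inr t => (s != t) && (s >=< t)%O
  end.

Fact graph_cylinder_adj_sym : symmetric graph_cylinder_adj.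
Proof.
by case=> [a|s] [b|t] //=; [apply: adj_sym | rewrite eq_sym comparable_sym].
Qed.

Fact graph_cylinder_adj_irrefl : irreflexive graph_cylinder_adj.
Proof. by case=> [a|s] /=; rewrite ?adj_irrefl ?eqxx. Qed.

Definition graph_cylinder : sgraph :=
  SGraph graph_cylinder_adj_sym graph_cylinder_adj_irrefl.

Let Left : {set graph_cylinder} := [set x | if x is inl _ then true else false].
Let Right : {set graph_cylinder} := [set x | if x is inl _ then false else true].

Lemma graph_cylinder_left :
  collapses (@s_dismantlable_in graph_cylinder) [set: graph_cylinder] Left.
Proof.
have -> : Left = [set: graph_cylinder] :\: Right.
  by apply/setP=> -[a|s]; rewrite !inE.
(* Largest cliques first; the value 0 on vertices is a default, as only cliques are removed here. *)
pose r (x : graph_cylinder) := if x is inr s then #|~: clique_set s| else 0.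
apply: (@collapses_ranked _ _ r); first exact: subsetT.
move=> B [a|s] sB _ sinB; rewrite inE // => _ mins.
have [a as_] := set0Pn _ (clique_neq0 s).
apply: dominated_s_dismantlable; exists (inl a); split=> //.
  by apply: (subsetP sB); rewrite !inE.
have sa t : clique_set t \subset clique_set s ->
    clique_set t \subset closed_nbhd [set: G] a.
  move=> ts; apply/subsetP=> y /(subsetP ts) ys; rewrite !inE.
  by have [//|neq_ya] := eqVneq y a; rewrite (clique_complete as_ ys) // eq_sym.
apply/subsetP=> -[b|t]; rewrite !inE /=.
  move=> /andP[bB sub]; rewrite bB /=.
  have := subsetP sub _ as_; rewrite !inE /= adj_sym.
  by case/predU1P => [->|->]; rewrite ?eqxx ?orbT.
case/predU1P=> [[->]|/and3P[tB neq_st st]]; first by rewrite sinB; apply: sa.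
rewrite tB; apply: sa; case/orP: st => //; rewrite clique_leE => st.
have : r (inr s) <= r (inr t) by apply: mins; rewrite ?inE.
rewrite leqNgt proper_card // properC properEneq st andbT.
by rewrite (inj_eq (@clique_set_inj G)).
Qed.

Lemma graph_cylinder_right :
  collapses (@s_dismantlable_in graph_cylinder) [set: graph_cylinder] Right.
Proof.
have -> : Right = [set: graph_cylinder] :\: Left.
  by apply/setP=> -[a|s]; rewrite !inE.
apply: (@collapses_ranked _ _ (fun=> 0)); first exact: subsetT.
move=> B [g|s] sB _ gB; rewrite inE // => _ _.
have RB t : (inr t : graph_cylinder) \in B by apply: (subsetP sB); rewrite !inE.
have [c def_c] := clique1 g.
pose N := @open_nbhd graph_cylinder B (inl g).
(* The cliques in the neighbourhood that miss [g] are removed first; every remaining clique contains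
   [{g}] and every remaining vertex is adjacent to [g], so [{g}] is a cone point. *)
pose D := [set x in N | if x is inr s then g \notin clique_set s else false].
rewrite /s_dismantlable_in -/N.
apply: (@collapses_dismantlable _ _ _ (N :\: D)); last first.
  apply: (@graph_cone_dismantlable graph_cylinder _ (inr c)).
    by rewrite !inE RB /= def_c set11 andbF /= sub1set !inE eqxx.
  move=> [h|s]; rewrite !inE /=.
    by move=> /andP[_ /andP[_ gh]] _; rewrite def_c sub1set !inE adj_sym gh orbT.
  rewrite RB /= => /andP[+ sN] neq_sc; rewrite sN /= negbK => gs.
  have le_cs : (c <= s)%O by rewrite clique_leE def_c sub1set.
  by rewrite /adj /= ge_comparable // andbT; apply: contraNneq neq_sc => ->.
pose r (x : graph_cylinder) := if x is inr s then #|~: clique_set s| else 0.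
apply: (@collapses_ranked _ _ r).
  by apply/subsetP=> x; rewrite inE => /andP[].
move=> B' [h|s] sB' sB'N sinB'; rewrite !inE ?andbF //= => /andP[/andP[_ sN] gs] mins.
(* By [sN], [s] lies in the closed neighbourhood of [g], so adding [g] gives a clique; it will
   dominate [s]. *)
have [t def_t] : exists t, clique_set t = g |: clique_set s.
  apply: clique_setU1 => x /(subsetP sN); rewrite !inE /=.
  by rewrite adj_sym => /predU1P [->|//]; rewrite eqxx.
have lt_st : (s < t)%O.
  rewrite clique_ltE def_t properE subsetUr.
  by apply/subsetPn; exists g; rewrite ?inE ?eqxx.
exists (inr t); split.
- apply: (subsetP sB'); rewrite !inE RB /= def_t !inE eqxx andbF /=.
  by rewrite subUset sub1set sN !inE eqxx.
- by apply: contraTneq lt_st => -[->]; rewrite ltxx.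
apply/subsetP=> -[h|u]; rewrite !inE /=.
  (* A vertex [h] of [B'] lies in [N], so it is a neighbour of [g]: its closed neighbourhood
     contains [g] as well as [s]. *)
  move=> /andP[hB' sNh]; rewrite hB' def_t subUset sub1set sNh andbT !inE /=.
  by have := subsetP sB'N _ hB'; rewrite !inE /= adj_sym => /andP[_ ->]; rewrite orbT.
case/predU1P=> [[->]|/and3P[uB' neq_su]].
  by rewrite sinB' (gt_comparable lt_st) (gt_eqF lt_st) orbT.
case: (eqVneq u t) => [->|neq_ut] su; first by rewrite eqxx.
rewrite uB'; apply/orP; right=> /=.
case/orP: su => [su|us]; last by rewrite ge_comparable // (le_trans us (ltW lt_st)).
rewrite le_comparable // clique_leE def_t subUset -clique_leE su andbT sub1set.
(* A clique [u] above [s] without [g] would belong to [D] and be larger than [s], against the order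
   of removal. *)
apply: contraT => gu.
have : r (inr s) <= r (inr u).
  by apply: mins => //; have := subsetP sB'N _ uB'; rewrite !inE gu /= => ->.
by rewrite leqNgt proper_card // properC -clique_ltE lt_neqAle neq_su.
Qed.

Lemma same_s_Comp_C : same_s_homotopy_type G (Comp (C G)).
Proof.
have left : graph_iso G (induced Left).
  apply: (@induced_iso G graph_cylinder inl) => [a b [//]|//|a|[a _|s]].
  - by rewrite inE.
  - by exists a.
  by rewrite inE.
have right : graph_iso (Comp (C G)) (induced Right).
  apply: (@induced_iso (Comp (C G)) graph_cylinder inr) => [s t [//]|//|s|[a|s _]].
  - by rewrite inE.
  - by rewrite inE.
  by exists s.
apply: same_s_trans (same_s_iso left) _.
apply: same_s_trans (same_s_sym (same_s_iso right)).
apply: same_s_trans (collapses_same_s_setT graph_cylinder_right).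
exact: same_s_sym (collapses_same_s_setT graph_cylinder_left).
Qed.

End CylinderGraph.

(** * The cylinder joining a poset to the poset of its chains *)

Section CylinderPoset.
Local Open Scope order_scope.

Lemma poset_dismantlable_imset d (P : finPOrderType d)
    d' (Q : finPOrderType d') (f : P -> Q) (A : {set P}) :
    {mono f : x y / x <= y} ->
  poset_dismantlable A -> poset_dismantlable (f @: A).
Proof.
move=> f_le; apply: dismantlable_by_imset => [|{}A x xA].
  exact: inc_inj f_le.
rewrite /irreducible_in below_imset // above_imset //.
case=> -[m mA ext]; [left | right]; exists (f m); rewrite ?imset_f //;
  by move=> _ /imsetP [y yA ->]; rewrite f_le ext.
Qed.

Variables (d : Order.disp_t) (P : finPOrderType d).

(** An element with the most points of [P] below it is the maximum, because any other element of the
    chain is comparable to it. *)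
Lemma chain_has_maximum (c : C (Comp P)) : @has_maximum _ P (clique_set c).
Proof.
have [x0 x0c] := set0Pn _ (clique_neq0 c).
case: (@arg_maxnP _ x0 (fun x => x \in clique_set c)
         (fun x : P => #|below [set: P] x|) x0c) => m mc maxm.
exists m => // y yc; apply: contraT => not_ym.
have neq_my : m != y by apply: contraNneq not_ym => ->.
have := clique_complete mc yc neq_my; rewrite /adj /= => /andP[_].
rewrite /Order.comparable (negPf not_ym) orbF => le_my.
have lt_my : m < y by rewrite lt_neqAle neq_my.
have := maxm y yc; rewrite /= leqNgt; apply: contraNT => _.
by apply: card_below_lt; rewrite ?inE.
Qed.

Definition poset_cylinder : Type := (P + C (Comp P))%type.
HB.instance Definition _ := Finite.copy poset_cylinder (P + C (Comp P))%type.

(** This is the mapping cylinder of the map sending a chain to its maximum: [inr c <= inl p] says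
    that the maximum of [c] is at most [p]. *)
Definition poset_cylinder_le : rel poset_cylinder := fun x y =>
  match x, y with
  | inl p, inl q => p <= q
  | inl _, inr _ => false
  | inr c, inl p => [forall q in clique_set c, (q : P) <= p]
  | inr c, inr e => c <= e
  end.

Fact poset_cylinder_le_refl : reflexive poset_cylinder_le.
Proof. by case=> [p|c] /=; rewrite lexx. Qed.

Fact poset_cylinder_le_anti : antisymmetric poset_cylinder_le.
Proof.
case=> [p|c] [q|e] //=; first by move/le_anti->.
  by rewrite andbF.
by move/le_anti->.
Qed.

Fact poset_cylinder_le_trans : transitive poset_cylinder_le.
Proof.
case=> [q|e] [p|c] [r|u] //=; first exact: le_trans.
- move=> /forall_inP cq qr; apply/forall_inP=> x xc.
  exact: le_trans (cq x xc) qr.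
- move=> ce /forall_inP er; apply/forall_inP=> x xc; apply: er.
  by move: ce; rewrite clique_leE => /subsetP->.
exact: le_trans.
Qed.

HB.instance Definition _ :=
  Order.Le_isPOrder.Build d poset_cylinder
    poset_cylinder_le_refl poset_cylinder_le_anti poset_cylinder_le_trans.

Let Left : {set poset_cylinder} := [set x | if x is inl _ then true else false].
Let Right : {set poset_cylinder} := [set x | if x is inl _ then false else true].

Lemma poset_cylinder_left :
  collapses (@weak_in _ poset_cylinder) [set: poset_cylinder] Left.
Proof.
have -> : Left = [set: poset_cylinder] :\: Right.
  by apply/setP=> -[a|s]; rewrite !inE.
pose r (x : poset_cylinder) := if x is inr s then #|~: clique_set s| else 0.
apply: (@collapses_ranked _ _ r); first exact: subsetT.
move=> B [a|s] sB _ sinB; rewrite inE // => _ mins.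
have [m mc maxm] := chain_has_maximum s.
apply: irreducible_weak; right; exists (inl m).
  rewrite inE (subsetP sB) ?inE // lt_neqAle /=.
  by apply/forall_inP.
move=> [q|t]; rewrite inE => /andP[tB]; rewrite lt_neqAle => /andP[neq_st st].
  by have /forall_inP/(_ m mc) := st.
have : (r (inr s) <= r (inr t))%N by apply: mins; rewrite ?inE.
rewrite leqNgt proper_card // properC properEneq; apply/andP; split=> //.
Qed.

Lemma poset_cylinder_right :
  collapses (@weak_in _ poset_cylinder) [set: poset_cylinder] Right.
Proof.
have -> : Right = [set: poset_cylinder] :\: Left.
  by apply/setP=> -[a|s]; rewrite !inE.
pose r (x : poset_cylinder) := if x is inl p then #|below [set: P] p| else 0.
apply: (@collapses_ranked _ _ r); first exact: subsetT.
move=> B [p|s] sB _ pB; rewrite inE // => _ minp; left.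
pose S : {set Comp P} := [set q : P | q <= p].
(* Smaller points are gone, so only chains remain below [p]; with [Z] empty, [cliques_over] gives
   all nonempty chains of the cone [S], whose apex in [Comp P] is [p]. *)
have -> : below B (inl p) = inr @: cliques_over set0 S.
  apply/setP=> -[q|c]; rewrite inE.
    apply/andP/imsetP => [[qB lt_qp]|[]//].
    have {}lt_qp : q < p.
      move: lt_qp; rewrite !lt_neqAle => /andP[neq_qp le_qp].
      by apply/andP; split.
    have : (r (inl p) <= r (inl q))%N by apply: minp; rewrite ?inE.
    by rewrite leqNgt /r card_below_lt ?inE.
  rewrite (subsetP sB) ?inE // mem_imset; last by move=> ? ? [].
  rewrite inE sub0set set0U subset0 clique_neq0 andbT lt_neqAle /=.
  by apply/forall_inP/subsetP => cp x /cp; rewrite inE.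
apply: poset_dismantlable_imset => //; apply: cliques_over_dismantlable.
- by apply/is_completeP=> x; rewrite inE.
- by move=> x y; rewrite inE.
apply: (@graph_cone_dismantlable _ _ (p : Comp P)); first by rewrite inE /=.
by move=> q; rewrite inE /adj /= => qp ->; rewrite le_comparable.
Qed.

Lemma simply_C_Comp : simply_equivalent P (C (Comp P)).
Proof.
have left : poset_iso P (subposet Left).
  apply: (@subposet_iso _ P _ poset_cylinder inl) => [//|p|[p _|c]].
  - by rewrite inE.
  - by exists p.
  by rewrite inE.
have right : poset_iso (C (Comp P)) (subposet Right).
  apply: (@subposet_iso _ (C (Comp P)) _ poset_cylinder inr) => [//|c|[p|c _]].
  - by rewrite inE.
  - by rewrite inE.
  by exists c.
apply: simply_trans (simply_iso left) _.
apply: simply_trans (simply_sym (simply_iso right)).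
apply: simply_trans (collapses_simply_setT poset_cylinder_right).
exact: simply_sym (collapses_simply_setT poset_cylinder_left).
Qed.

End CylinderPoset.

Theorem theorem3p5 :
  (forall (d d' : Order.disp_t) (P : finPOrderType d) (Q : finPOrderType d'),
     simply_equivalent P Q <-> same_s_homotopy_type (Comp P) (Comp Q)) /\
  (forall G H : sgraph,
     same_s_homotopy_type G H <-> simply_equivalent (C G) (C H)).
Proof.
split=> [d d' P Q|G H]; split.
- exact: simply_equivalent_Comp.
(* Each converse applies the other functor, then returns to the original objects through the
   comparison given by the cylinder. *)
- move/same_s_homotopy_type_C=> simplyC; apply: simply_trans (simply_C_Comp P) _.
  exact: simply_trans simplyC (simply_sym (simply_C_Comp Q)).
- exact: same_s_homotopy_type_C.
move/simply_equivalent_Comp=> sameComp; apply: same_s_trans (same_s_Comp_C G) _.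
exact: same_s_trans sameComp (same_s_sym (same_s_Comp_C H)).
Qed.
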